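(* (1) Let $\mathcal G$ be the class of all groups $G$ such that for every $a\in G\setminus\{e\}$, $C_G(a^G)=\{e\}$. Then $\mathcal G$ recognizes coordinates. (2) For a prime $p$, let $\mathcal G_p$ be the class of all groups $G$ which have elements of order $p$ and such that for every $a\in G$ of order $p$, $C_G(a^G)=\{e\}$. Then $\mathcal G_p$ recognizes coordinates.
   Context: Groups are considered in the language $\{\cdot,{}^{-1},e\}$. $a^G$ is the conjugacy class of $a$ and $C_G(S)$ is the centralizer of $S\subseteq G$. Reduced product: for an ideal $\mathcal I$ on $\mathbb I$ (closed under subsets and finite unions, $\mathbb I\notin\mathcal I$), $\prod_{\mathcal I}G_i$ is $\prod_iG_i$ modulo $(a_i)\simeq(b_i)\iff\{i\mid a_i\neq b_i\}\in\mathcal I$, operations coordinatewise; for $S\in\mathcal P(\mathbb I)/\mathcal I$ with representative $\tilde S$, $\mathcal M\restriction S=\prod_{i\in\tilde S}G_i/(\mathcal I\restriction\tilde S)$ with quotient map $\pi_S$. An isomorphism $\Phi:\prod_{\mathcal I}G_i\to\prod_{\mathcal J}H_j$ is isomorphically coordinate respecting if there is an isomorphism $\alpha:\mathcal P(\mathbb I)/\mathcal I\to\mathcal P(\mathbb J)/\mathcal J$ such that for all $S$ there is a well-defined map $\Phi_S$ with $\Phi_S(\pi_S(a))=\pi_{\alpha(S)}(\Phi(a))$. A class of structures recognizes coordinates if every isomorphism between reduced products (any index sets and ideals, repetitions allowed) of its members is isomorphically coordinate respecting.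
   Formalization: In (1) the class is restricted to nontrivial groups: the trivial group satisfies the centralizer condition vacuously, and reduced products of trivial groups over index sets of sizes 1 and 2 are isomorphic although the quotient power sets are not. *)

(* Defs.v *)
From HB Require Import structures.
From mathcomp Require Import all_boot all_order.
From mathcomp Require Import mathcomp_extra boolp classical_sets.

Set Implicit Arguments.
Unset Strict Implicit.
Unset Printing Implicit Defensive.

Local Open Scope classical_set_scope.
Local Open Scope quotient_scope.
Local Open Scope group_scope.

(* Properness is not part of the record: the restriction of an ideal to one of
   its own members is improper, and M|S is formed for such S as well.         *)
Record ideal (T : Type) := Ideal {
  ideal_set :> set T -> Prop;
  ideal0 : ideal_set set0;
  ideal_sub : forall A B, A `<=` B -> ideal_set B -> ideal_set A;
  idealU : forall A B, ideal_set A -> ideal_set B -> ideal_set (A `|` B)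
}.

Definition proper_ideal (T : Type) (I : ideal T) : Prop := ~ I [set: T].

Section RestrictIdeal.
Context {T : Type} (I : ideal T) (S : set T).

Definition restr_ideal_set : set (set S) :=
  [set A | I ((val : S -> T) @` A)].

Fact restr_ideal0 : restr_ideal_set set0.
Proof. by rewrite /restr_ideal_set /= image_set0; exact: ideal0. Qed.

Fact restr_ideal_sub A B :
  A `<=` B -> restr_ideal_set B -> restr_ideal_set A.
Proof. by move=> AB; apply: ideal_sub; exact: image_subset. Qed.

Fact restr_idealU A B :
  restr_ideal_set A -> restr_ideal_set B -> restr_ideal_set (A `|` B).
Proof. by move=> IA IB; rewrite /restr_ideal_set /= image_setU; exact: idealU. Qed.

Definition restr_ideal : ideal S :=
  Ideal restr_ideal0 restr_ideal_sub restr_idealU.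

End RestrictIdeal.

Fact pow_quot_display : Order.disp_t. Proof. exact: Order.Disp tt tt. Qed.

Section PowerQuotient.
Context {T : Type} (I : ideal T).

Definition eq_mod_ideal : rel (set T) := fun A B => `[< I (A `+` B) >].

Fact eq_mod_ideal_refl : reflexive eq_mod_ideal.
Proof. by move=> A; apply/asboolP; rewrite setYK; exact: ideal0. Qed.

Fact eq_mod_ideal_sym : symmetric eq_mod_ideal.
Proof. by move=> A B; rewrite /eq_mod_ideal setYC. Qed.

Fact eq_mod_ideal_trans : transitive eq_mod_ideal.
Proof.
move=> B A C /asboolP AB /asboolP BC; apply/asboolP.
apply: ideal_sub (idealU AB BC) => x; rewrite /setY /=.
by have [] := pselect (B x); tauto.
Qed.

Canonical eq_mod_ideal_equiv :=
  EquivRel eq_mod_ideal eq_mod_ideal_refl eq_mod_ideal_sym eq_mod_ideal_trans.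

Definition pow_quot : Type := {eq_quot eq_mod_ideal}.

HB.instance Definition _ := Choice.on pow_quot.
HB.instance Definition _ := EqQuotient.on pow_quot.

Lemma pow_quotP (A B : set T) :
  \pi_pow_quot A = \pi_pow_quot B <-> I (A `+` B).
Proof.
by split => [/eqP|h]; [rewrite eqmodE => /asboolP | apply/eqmodP/asboolP].
Qed.

Lemma pow_quot_repr (A : set T) : I (A `+` repr (\pi_pow_quot A)).
Proof. by apply/pow_quotP; rewrite reprK. Qed.

Definition pow_meet (x y : pow_quot) : pow_quot := \pi_pow_quot (repr x `&` repr y).
Definition pow_join (x y : pow_quot) : pow_quot := \pi_pow_quot (repr x `|` repr y).
Definition pow_compl (x : pow_quot) : pow_quot := \pi_pow_quot (~` repr x).
Definition pow_bot : pow_quot := \pi_pow_quot (set0 : set T).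
Definition pow_top : pow_quot := \pi_pow_quot (setT : set T).
Definition pow_le (x y : pow_quot) : bool := pow_meet x y == x.
Definition pow_lt (x y : pow_quot) : bool := (y != x) && pow_le x y.

Lemma pi_meet A B : pow_meet (\pi_pow_quot A) (\pi_pow_quot B) = \pi_pow_quot (A `&` B).
Proof.
apply/pow_quotP; apply: ideal_sub (idealU (pow_quot_repr A) (pow_quot_repr B)).
move=> x; rewrite /setY /=.
case: (pselect (A x)); case: (pselect (B x));
case: (pselect (repr (\pi_pow_quot A) x));
by case: (pselect (repr (\pi_pow_quot B) x)); tauto.
Qed.

Lemma pi_join A B : pow_join (\pi_pow_quot A) (\pi_pow_quot B) = \pi_pow_quot (A `|` B).
Proof.
apply/pow_quotP; apply: ideal_sub (idealU (pow_quot_repr A) (pow_quot_repr B)).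
move=> x; rewrite /setY /=.
case: (pselect (A x)); case: (pselect (B x));
case: (pselect (repr (\pi_pow_quot A) x));
by case: (pselect (repr (\pi_pow_quot B) x)); tauto.
Qed.

Lemma pi_compl A : pow_compl (\pi_pow_quot A) = \pi_pow_quot (~` A).
Proof.
apply/pow_quotP; apply: ideal_sub (pow_quot_repr A).
move=> x; rewrite /setY /=.
by case: (pselect (A x)); case: (pselect (repr (\pi_pow_quot A) x)); tauto.
Qed.

Fact pow_le_def x y : pow_le x y = (pow_meet x y == x).
Proof. by []. Qed.
Fact pow_lt_def x y : pow_lt x y = (y != x) && pow_le x y.
Proof. by []. Qed.
Fact pow_meetC : commutative pow_meet.
Proof. by elim/quotW => A; elim/quotW => B; rewrite !pi_meet setIC. Qed.
Fact pow_joinC : commutative pow_join.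
Proof. by elim/quotW => A; elim/quotW => B; rewrite !pi_join setUC. Qed.
Fact pow_meetA : associative pow_meet.
Proof.
elim/quotW => A; elim/quotW => B; elim/quotW => C.
by rewrite (pi_meet B C) (pi_meet A B) !pi_meet setIA.
Qed.
Fact pow_joinA : associative pow_join.
Proof.
elim/quotW => A; elim/quotW => B; elim/quotW => C.
by rewrite (pi_join B C) (pi_join A B) !pi_join setUA.
Qed.
Fact pow_joinKI y x : pow_meet x (pow_join x y) = x.
Proof.
by elim/quotW: x => A; elim/quotW: y => B; rewrite (pi_join A) pi_meet setUC setKU.
Qed.
Fact pow_meetKU y x : pow_join x (pow_meet x y) = x.
Proof.
by elim/quotW: x => A; elim/quotW: y => B; rewrite (pi_meet A) pi_join setIC setKI.
Qed.
Fact pow_meetUl : left_distributive pow_meet pow_join.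
Proof.
elim/quotW => A; elim/quotW => B; elim/quotW => C.
by rewrite (pi_join A B) (pi_meet A C) (pi_meet B C) pi_meet pi_join setIUl.
Qed.
Fact pow_meetxx : idempotent_op pow_meet.
Proof. by elim/quotW => A; rewrite pi_meet setIid. Qed.

HB.instance Definition _ :=
  Order.isMeetJoinDistrLattice.Build pow_quot_display pow_quot
    pow_le_def pow_lt_def pow_meetC pow_joinC pow_meetA pow_joinA
    pow_joinKI pow_meetKU pow_meetUl pow_meetxx.

Fact pow_le0x x : (pow_bot <= x)%O.
Proof.
by elim/quotW: x => A; rewrite /Order.le /= /pow_le pi_meet set0I.
Qed.
Fact pow_lex1 x : (x <= pow_top)%O.
Proof.
by elim/quotW: x => A; rewrite /Order.le /= /pow_le pi_meet setIT.
Qed.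

HB.instance Definition _ :=
  Order.hasBottom.Build pow_quot_display pow_quot pow_le0x.
HB.instance Definition _ :=
  Order.hasTop.Build pow_quot_display pow_quot pow_lex1.

Fact pow_joinxC x : (x `|` pow_compl x = \top)%O.
Proof.
elim/quotW: x => A; rewrite pi_compl.
by rewrite [LHS]pi_join setUv.
Qed.
Fact pow_meetxC x : (x `&` pow_compl x = \bot)%O.
Proof.
elim/quotW: x => A; rewrite pi_compl.
by rewrite [LHS]pi_meet setICr.
Qed.

HB.instance Definition _ :=
  Order.TBDistrLattice_hasComplement.Build pow_quot_display pow_quot
    pow_joinxC pow_meetxC.

End PowerQuotient.

Definition boolean_iso (d d' : Order.disp_t) (A : ctbDistrLatticeType d)
    (B : ctbDistrLatticeType d') (f : A -> B) : Prop :=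
  [/\ bijective f,
      {morph f : x y / (x `&` y)%O},
      {morph f : x y / (x `|` y)%O},
      {morph f : x / (~` x)%O} &
      f \bot%O = \bot%O /\ f \top%O = \top%O].

Section ReducedProduct.
Context {T : Type} (I : ideal T) (G : T -> groupType).

Definition prod_group : Type := forall i, G i.

HB.instance Definition _ := gen_eqMixin prod_group.
HB.instance Definition _ := gen_choiceMixin prod_group.

Definition prod_eq_mod : rel prod_group :=
  fun a b => `[< I [set i | a i <> b i] >].

Fact prod_eq_mod_refl : reflexive prod_eq_mod.
Proof. by move=> a; apply/asboolP; apply: ideal_sub (ideal0 I) => i /=. Qed.

Fact prod_eq_mod_sym : symmetric prod_eq_mod.
Proof.
by move=> a b; apply/asboolP/asboolP; apply: ideal_sub => i /= + /esym.
Qed.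

Fact prod_eq_mod_trans : transitive prod_eq_mod.
Proof.
move=> b a c /asboolP ab /asboolP bc; apply/asboolP.
apply: ideal_sub (idealU ab bc) => i /= ac.
by have [eab|] := pselect (a i = b i); [right; rewrite -eab|left].
Qed.

Canonical prod_eq_mod_equiv :=
  EquivRel prod_eq_mod prod_eq_mod_refl prod_eq_mod_sym prod_eq_mod_trans.

Definition reduced_product : Type := {eq_quot prod_eq_mod}.

HB.instance Definition _ := Choice.on reduced_product.
HB.instance Definition _ := EqQuotient.on reduced_product.

Lemma reduced_productP (a b : prod_group) :
  \pi_reduced_product a = \pi_reduced_product b <-> I [set i | a i <> b i].
Proof.
by split => [/eqP|h]; [rewrite eqmodE => /asboolP | apply/eqmodP/asboolP].
Qed.

Lemma reduced_product_repr (a : prod_group) :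
  I [set i | a i <> repr (\pi_reduced_product a) i].
Proof. by apply/reduced_productP; rewrite reprK. Qed.

Definition redprod_one : reduced_product := \pi_reduced_product (fun i => 1 : G i).
Definition redprod_mul (x y : reduced_product) : reduced_product :=
  \pi_reduced_product (fun i => repr x i * repr y i).
Definition redprod_inv (x : reduced_product) : reduced_product :=
  \pi_reduced_product (fun i => (repr x i)^-1).

Lemma pi_redprod_mul (a b : prod_group) :
  redprod_mul (\pi_reduced_product a) (\pi_reduced_product b) = \pi_reduced_product (fun i => a i * b i).
Proof.
apply/esym/reduced_productP.
apply: ideal_sub (idealU (reduced_product_repr a) (reduced_product_repr b)).
move=> i /= ne; apply: contrapT => /not_orP[/contrapT ea /contrapT eb].
by apply: ne; rewrite -ea -eb.
Qed.

Lemma pi_redprod_inv (a : prod_group) :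
  redprod_inv (\pi_reduced_product a) = \pi_reduced_product (fun i => (a i)^-1).
Proof.
apply/esym/reduced_productP; apply: ideal_sub (reduced_product_repr a).
by move=> i /= ne ea; apply: ne; rewrite -ea.
Qed.

Fact redprod_mulA : associative redprod_mul.
Proof.
elim/quotW => a; elim/quotW => b; elim/quotW => c.
rewrite (pi_redprod_mul b c) (pi_redprod_mul a b) !pi_redprod_mul.
by congr (\pi_reduced_product _); apply: functional_extensionality_dep => i; rewrite mulgA.
Qed.
Fact redprod_mul1 : left_id redprod_one redprod_mul.
Proof.
elim/quotW => a; rewrite pi_redprod_mul.
by congr (\pi_reduced_product _); apply: functional_extensionality_dep => i; rewrite mul1g.
Qed.
Fact redprod_mulr1 : right_id redprod_one redprod_mul.
Proof.
elim/quotW => a; rewrite pi_redprod_mul.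
by congr (\pi_reduced_product _); apply: functional_extensionality_dep => i; rewrite mulg1.
Qed.
Fact redprod_mulV : left_inverse redprod_one redprod_inv redprod_mul.
Proof.
elim/quotW => a; rewrite pi_redprod_inv pi_redprod_mul.
by congr (\pi_reduced_product _); apply: functional_extensionality_dep => i; rewrite mulVg.
Qed.
Fact redprod_mulrV : right_inverse redprod_one redprod_inv redprod_mul.
Proof.
elim/quotW => a; rewrite pi_redprod_inv pi_redprod_mul.
by congr (\pi_reduced_product _); apply: functional_extensionality_dep => i; rewrite mulgV.
Qed.

HB.instance Definition _ := isGroup.Build reduced_product
  redprod_mulA redprod_mul1 redprod_mulr1 redprod_mulV redprod_mulrV.

End ReducedProduct.

(* M|S, formed from the representative [repr S] of S.                         *)
Definition restr_product (T : Type) (I : ideal T) (G : T -> groupType)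
    (S : pow_quot I) : groupType :=
  reduced_product (restr_ideal I (repr S)) (fun i : repr S => G (val i)).

Definition restr_proj (T : Type) (I : ideal T) (G : T -> groupType)
    (S : pow_quot I) (x : reduced_product I G) : restr_product G S :=
  \pi_(reduced_product (restr_ideal I (repr S)) (fun i : repr S => G (val i)))
    (fun i => repr x (val i)).

Lemma restr_proj_pi (T : Type) (I : ideal T) (G : T -> groupType)
    (S : pow_quot I) (a : prod_group G) :
  restr_proj S (\pi_(reduced_product I G) a) =
  \pi_(reduced_product (restr_ideal I (repr S)) (fun i : repr S => G (val i)))
    (fun i => a (val i)).
Proof.
apply/esym/reduced_productP.
by apply: ideal_sub (reduced_product_repr I a) => _ [i /= ne <-].
Qed.

Definition coordinate_respecting (T T' : Type) (I : ideal T) (J : ideal T')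
    (G : T -> groupType) (H : T' -> groupType)
    (Phi : reduced_product I G -> reduced_product J H) : Prop :=
  exists2 alpha : pow_quot I -> pow_quot J, boolean_iso alpha &
    forall S : pow_quot I,
      exists Phi_S : restr_product G S -> restr_product H (alpha S),
        forall a : reduced_product I G,
          Phi_S (restr_proj S a) = restr_proj (alpha S) (Phi a).

Definition recognizes_coordinates (C : groupType -> Prop) : Prop :=
  forall (T T' : Type) (I : ideal T) (J : ideal T')
    (G : T -> groupType) (H : T' -> groupType),
    proper_ideal I -> proper_ideal J ->
    (forall i, C (G i)) -> (forall j, C (H j)) ->
    forall Phi : {multiplicative reduced_product I G -> reduced_product J H},
      bijective Phi -> coordinate_respecting Phi.

Definition conj_class (G : groupType) (a : G) : set G :=
  [set a ^ g | g in [set: G]].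

Definition centralizer (G : groupType) (S : set G) : set G :=
  [set g | forall s, S s -> commute g s].

Definition has_order (G : groupType) (n : nat) (a : G) : Prop :=
  [/\ (0 < n)%N, a ^+ n = 1 &
      forall m, (0 < m < n)%N -> a ^+ m <> 1].

(* The trivial group satisfies the centralizer condition vacuously and must be
   excluded: all reduced products of trivial groups are isomorphic, whatever
   P(T)/I is, so no class containing it recognizes coordinates.               *)
Definition class_G (G : groupType) : Prop :=
  (exists a : G, a <> 1) /\
  forall a : G, a <> 1 -> centralizer (conj_class a) = [set 1].

Definition class_Gp (p : nat) (G : groupType) : Prop :=
  (exists a : G, has_order p a) /\
  forall a : G, has_order p a -> centralizer (conj_class a) = [set 1].

(* Main.v *)
(** If [x] in the reduced product [M] satisfies [x ^+ n = 1], then under the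
    centralizer hypothesis [C_M(x^M)] consists of the elements whose support is
    disjoint from that of [x] modulo the ideal. As every class of the quotient
    power set is the support of such an [x], an isomorphism [Phi] induces an
    order isomorphism [supp x |-> supp (Phi x)], and [restr_proj S a =
    restr_proj S b] says that [a / b] lies in [C_M(x^M)] for [supp x = S].
    Both parts are instances: [n = 0] gives the first, [n = p] the second. *)
From HB Require Import structures.
Require Import Defs.
From mathcomp Require Import all_boot.
From mathcomp Require Import all_order.
From mathcomp Require Import mathcomp_extra boolp classical_sets.

Set Implicit Arguments.
Unset Strict Implicit.
Unset Printing Implicit Defensive.

Import Order.Theory.

Local Open Scope classical_set_scope.
Local Open Scope quotient_scope.
Local Open Scope group_scope.

(** The order determines all Boolean operations. The adjunctions [lef] and [gef] give the
    inequalities that monotonicity alone does not; complements then follow from disjointness. *)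
Lemma le_mono_boolean_iso (d d' : Order.disp_t) (A : ctbDistrLatticeType d)
    (B : ctbDistrLatticeType d') (f : A -> B) :
  {mono f : x y / (x <= y)%O} -> (forall y, exists x, f x = y) ->
  boolean_iso f.
Proof.
move=> fle /choice[g gK].
have fK : cancel f g by move=> x; apply: (inc_inj fle); rewrite gK.
have lef x y : (f x <= y)%O = (x <= g y)%O by rewrite -fle gK.
have gef x y : (x <= f y)%O = (g x <= y)%O by rewrite -fle gK.
have fI : {morph f : x y / (x `&` y)%O}.
  move=> x y; apply/le_anti; rewrite lexI !fle leIl leIr /=.
  by rewrite gef lexI -!gef leIl leIr.
have fU : {morph f : x y / (x `|` y)%O}.
  move=> x y; apply/le_anti; rewrite leUx !fle leUl leUr !andbT.
  by rewrite lef leUx -!lef leUl leUr.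
have f0 : f \bot%O = \bot%O by apply/le_anti; rewrite lef !le0x.
have f1 : f \top%O = \top%O by apply/le_anti; rewrite gef !lex1.
split=> //; first by exists g.
move=> x; apply/le_anti; rewrite -disj_leC -fI meetCx f0 eqxx /=.
by rewrite -[leRHS]complK -disj_leC -complU -fU joinxC f1 compl1.
Qed.

Lemma disj_subP (d : Order.disp_t) (A : ctbDistrLatticeType d) (x y : A) :
  (x <= y)%O <-> (forall z, (z `&` y)%O = \bot%O -> (z `&` x)%O = \bot%O).
Proof.
split=> [xy z /eqP zy|h].
  by apply/eqP; rewrite -lex0 -(eqP zy) leI2.
by rewrite -(complK y) -disj_leC meetC h // meetCx.
Qed.

Lemma disj_pow_quotP (T : Type) (I : ideal T) (A B : set T) :
  (\pi_(pow_quot I) A `&` \pi_(pow_quot I) B)%O = \bot%O <-> I (A `&` B).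
Proof.
by rewrite [(_ `&` _)%O]pi_meet pow_quotP setY0.
Qed.

Section Support.
Context {T : Type} (I : ideal T) (G : T -> groupType).
Local Notation M := (reduced_product I G).

Definition supp (x : M) : pow_quot I := \pi_(pow_quot I) [set i | repr x i <> 1].

Lemma supp_pi (a : prod_group G) :
  supp (\pi_M a) = \pi_(pow_quot I) [set i | a i <> 1].
Proof.
apply/pow_quotP; apply: ideal_sub (reduced_product_repr I a) => i.
rewrite /setY /= => + e; rewrite -e; tauto.
Qed.

Lemma redprod_mulE (a b : prod_group G) :
  \pi_M a * \pi_M b = \pi_M (fun i => a i * b i).
Proof. exact: pi_redprod_mul. Qed.

Lemma redprod_invE (a : prod_group G) : (\pi_M a)^-1 = \pi_M (fun i => (a i)^-1).
Proof. exact: pi_redprod_inv. Qed.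

Lemma redprod_expE (a : prod_group G) n :
  \pi_M a ^+ n = \pi_M (fun i => a i ^+ n).
Proof.
elim: n => [//|n IHn]; rewrite expgS IHn redprod_mulE.
by congr \pi_M; apply: functional_extensionality_dep => i; rewrite expgS.
Qed.

Lemma redprod_conjE (a g : prod_group G) :
  \pi_M a ^ \pi_M g = \pi_M (fun i => a i ^ g i).
Proof. by rewrite /conjg redprod_invE (redprod_mulE a g) redprod_mulE. Qed.

Lemma redprod_commuteP (a b : prod_group G) :
  commute (\pi_M a) (\pi_M b) <-> I [set i | ~ commute (a i) (b i)].
Proof. by rewrite /commute (redprod_mulE a b) (redprod_mulE b a) reduced_productP. Qed.

Lemma restr_proj_eqP (S : pow_quot I) (x y : M) :
  restr_proj S x = restr_proj S y <-> (supp (x * y^-1) `&` S)%O = \bot%O.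
Proof.
elim/quotW: x => a; elim/quotW: y => b.
rewrite !restr_proj_pi reduced_productP redprod_invE redprod_mulE supp_pi.
rewrite -[X in (_ `&` X)%O]reprK disj_pow_quotP /= /restr_ideal_set /=.
rewrite (_ : _ @` _ = [set i | a i * (b i)^-1 <> 1] `&` repr S) //.
apply/seteqP; split=> [_ [i /= ne <-]|i [/= ne Si]].
  split; last exact: set_valP.
  by move=> /divg1_eq.
exists (exist _ i (mem_set Si)) => //= e; apply: ne.
by rewrite e mulgV.
Qed.

Lemma exists_supp n (S : pow_quot I) :
  (forall i, exists a : G i, a <> 1 /\ a ^+ n = 1) ->
  exists x : M, x ^+ n = 1 /\ supp x = S.
Proof.
move=> tors; pose t i := projT1 (cid (tors i)).
have tP i : t i <> 1 /\ t i ^+ n = 1 := projT2 (cid (tors i)).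
elim/quotW: S => A.
exists (\pi_M (fun i => if i \in A then t i else 1)); split.
  rewrite redprod_expE; congr \pi_M; apply: functional_extensionality_dep => i.
  by case: ifP => _; [have [] := tP i | rewrite expg1n].
rewrite supp_pi; congr \pi; apply/seteqP; split=> i /=.
  by case: ifPn => [/set_mem|].
by move=> Ai; rewrite mem_set //; have [] := tP i.
Qed.

End Support.

Section Centralizer.
Context {T : Type} (I : ideal T) (G : T -> groupType).
Local Notation M := (reduced_product I G).

Lemma centralizer_conj_classE (K : groupType) (x y : K) :
  centralizer (conj_class x) y <-> forall g, commute y (x ^ g).
Proof.
by split=> [h g|h _ [g _ <-]]; [apply: h; exists g | exact: h].
Qed.

(** Where both coordinates are nontrivial, some conjugate of [a i] fails to commute with [b i];
    these conjugators are glued into one element of the product. Where either coordinate is 1, every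
    conjugate commutes. *)
Lemma centralizer_suppP n (x y : M) :
  (forall i (a : G i), a <> 1 -> a ^+ n = 1 ->
     centralizer (conj_class a) = [set 1]) ->
  x ^+ n = 1 ->
  centralizer (conj_class x) y <-> (supp y `&` supp x)%O = \bot%O.
Proof.
move=> cG; elim/quotW: x => a; elim/quotW: y => b.
rewrite redprod_expE => /reduced_productP an.
rewrite centralizer_conj_classE !supp_pi disj_pow_quotP; split=> [h|h g].
  (* The conditions stand under the existential so that a conjugator can be chosen at every index,
     with 1 as default. *)
  have nc i : exists g : G i, b i <> 1 -> a i <> 1 -> a i ^+ n = 1 ->
      ~ commute (b i) (a i ^ g).
    have [[b1 a1 ain]|] := pselect [/\ b i <> 1, a i <> 1 & a i ^+ n = 1];
      last by move=> ne; exists 1 => ? ? ?; exfalso; apply: ne.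
    have : ~ centralizer (conj_class (a i)) (b i) by rewrite (cG i).
    by rewrite centralizer_conj_classE => /existsNP[g ?]; exists g.
  pose g i := projT1 (cid (nc i)).
  have gP i : b i <> 1 -> a i <> 1 -> a i ^+ n = 1 ->
    ~ commute (b i) (a i ^ g i) := projT2 (cid (nc i)).
  have := h (\pi_M g).
  rewrite redprod_conjE => /redprod_commuteP hg.
  (* The equation [a i ^+ n = 1] holds only modulo [I]; [an] absorbs the exceptional indices. *)
  apply: ideal_sub (idealU hg an) => i [/= b1 a1].
  have [e|?] := pselect (a i ^+ n = 1); last by right.
  by left; exact: gP.
elim/quotW: g => g.
rewrite redprod_conjE; apply/redprod_commuteP.
apply: ideal_sub h => i /= ne; split=> e; apply: ne; rewrite e.
  exact/commute_sym/commute1.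
by rewrite conj1g; exact: commute1.
Qed.

End Centralizer.

(** Cancelling in [f 1 * f 1 = f 1] gives [f 1 = 1]; the packed morphism opens up the lemmas on
    inverses, powers and conjugates. *)
Lemma multiplicative_umagma (K L : groupType) (f : {multiplicative K -> L}) :
  exists f1 : UMagmaMorphism.type K L, f1 = f :> (K -> L).
Proof.
have f1 : f 1 = 1 by apply: (@mulgI _ (f 1)); rewrite -gmulfM !mulg1.
pose f1M := isUMagmaMorphism.Build K L f (conj f1 gmulfM).
by exists (HB.pack_for (UMagmaMorphism.type K L) (f : K -> L) f1M).
Qed.

Lemma centralizer_conj_class_iso (K L : groupType)
    (f : UMagmaMorphism.type K L) (x y : K) : bijective f ->
  centralizer (conj_class (f x)) (f y) <-> centralizer (conj_class x) y.
Proof.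
move=> [f' fK f'K]; rewrite !centralizer_conj_classE; split=> h g.
  have := h (f g).
  by rewrite /commute -gmulfJ -!gmulfM => /(can_inj fK).
by rewrite -(f'K g) -gmulfJ; exact: gmulf_commute.
Qed.

(** Torsion is stated as an equation, without minimality of [n], so that it can be checked
    coordinatewise even where some coordinates are 1. *)
Definition torsion_centralizing n (K : groupType) : Prop :=
  (exists a : K, a <> 1 /\ a ^+ n = 1) /\
  forall a : K, a <> 1 -> a ^+ n = 1 -> centralizer (conj_class a) = [set 1].

Lemma torsion_centralizing_recognizes n :
  recognizes_coordinates (torsion_centralizing n).
Proof.
move=> T T' I J G H _ _ cG cH Phi0.
have [Phi <-] := multiplicative_umagma Phi0 => bPhi.
have [Psi PhiK PsiK] := bPhi.
have tG (S : pow_quot I) := exists_supp S (fun i => (cG i).1).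
have tH (S : pow_quot J) := exists_supp S (fun i => (cH i).1).
have Phin x : Phi x ^+ n = 1 <-> x ^+ n = 1.
  rewrite -gmulfXn -(@gmulf1 _ _ Phi).
  by split=> [/(can_inj PhiK)|->].
(* Only [x] has to be torsion: [y] will also be an arbitrary quotient [a * b^-1]. *)
have disjE x y : x ^+ n = 1 ->
    (supp y `&` supp x)%O = \bot%O <->
    (supp (Phi y) `&` supp (Phi x))%O = \bot%O.
  move=> xn; have Phixn := (Phin x).2 xn.
  rewrite -(centralizer_suppP _ (fun i => (cG i).2) xn).
  rewrite -(centralizer_suppP _ (fun i => (cH i).2) Phixn).
  by rewrite centralizer_conj_class_iso.
have leE x y : x ^+ n = 1 -> y ^+ n = 1 ->
    (supp (Phi x) <= supp (Phi y))%O = (supp x <= supp y)%O.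
  (* Inclusion is expressed by disjointness from test classes, each of which is a support, so
     [disjE] transfers it. *)
  move=> xn yn; apply/idP/idP => /disj_subP h; apply/disj_subP => S.
    by have [z [_ <-]] := tG S; rewrite (disjE y) // (disjE x) //; exact: h.
  have [z [_ <-]] := tH S; rewrite -(PsiK z) -!disjE //; exact: h.
pose t S := projT1 (cid (tG S)).
have tn S : t S ^+ n = 1 := (projT2 (cid (tG S))).1.
have suppt S : supp (t S) = S := (projT2 (cid (tG S))).2.
exists (fun S => supp (Phi (t S))).
  apply: le_mono_boolean_iso => [S S'|S]; first by rewrite leE // !suppt.
  have [y [yn <-]] := tH S; exists (supp (Psi y)).
  have Psiyn : Psi y ^+ n = 1 by apply/Phin; rewrite PsiK.
  (* The chosen [t (supp (Psi y))] may differ from [Psi y], but equal supports have equal images by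
     [leE] in both directions. *)
  by rewrite -{2}(PsiK y); apply/le_anti; rewrite !leE // suppt lexx.
move=> S.
have PhiS a b : restr_proj S a = restr_proj S b ->
    restr_proj (supp (Phi (t S))) (Phi a) = restr_proj (supp (Phi (t S))) (Phi b).
  rewrite !restr_proj_eqP -{1}(suppt S) (disjE _ _ (tn S)).
  by rewrite gmulfM gmulfV.
(* The default 1 makes the map total without a proof that [restr_proj S] is onto. *)
exists (fun u => if pselect (exists a, restr_proj S a = u) is left e
                 then restr_proj _ (Phi (projT1 (cid e))) else 1) => a.
case: pselect => [e|[]]; last by exists a.
by apply: PhiS; exact: projT2 (cid e).
Qed.

Lemma has_order_prime (K : groupType) p (a : K) :
  prime p -> has_order p a <-> a <> 1 /\ a ^+ p = 1.
Proof.
move=> pp; split=> [[_ ap am]|[a1 ap]].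
  by split=> // a1; apply: (am 1%N) => //; rewrite prime_gt1.
split=> [|//|m /andP[m0 mp] am]; first exact: prime_gt0.
(* Bezout: [u * m = v * p + 1], so [a ^+ m = 1] and [a ^+ p = 1] force [a = 1]. *)
have [u v e _] := egcdnP p m0; apply: a1.
have := prime_coprime m pp; rewrite gtnNdvd // coprime_sym => /eqP cop.
have : a ^+ (u * m) = a by rewrite e cop expgnDr expg1 mulnC expgnA ap expg1n mul1g.
by rewrite mulnC expgnA am expg1n.
Qed.

Lemma recognizes_coordinates_sub (C D : groupType -> Prop) :
  (forall K, C K -> D K) -> recognizes_coordinates D -> recognizes_coordinates C.
Proof.
move=> CD rD T T' I J G H pI pJ cG cH.
by apply: rD => // i; exact: CD.
Qed.

Theorem theorem4p3 :
  recognizes_coordinates class_G /\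
  (forall p : nat, prime p -> recognizes_coordinates (class_Gp p)).
Proof.
split=> [|p pp].
  apply: recognizes_coordinates_sub (torsion_centralizing_recognizes (n := 0%N)).
  move=> K [[a a1] cK]; split; first by exists a.
  by move=> b b1 _; exact: cK.
apply: recognizes_coordinates_sub (torsion_centralizing_recognizes (n := p)).
move=> K [[a /(has_order_prime _ pp) ap] cK]; split; first by exists a.
by move=> b b1 bp; apply: cK; apply/(has_order_prime _ pp).
Qed.
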